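(* Let $d$ be a positive integer, $U\subseteq\mathbb R$ an open interval and $m$ and $n$ integers such that $n$ is odd and $1 \le n \le m \le 2d$. If $f \in P_d(U)$ then $$|D^m f(x)| \le \frac{m!}{n!}\,\operatorname{dist}(x,\partial U)^{-(m-n)}\,|D^n f(x)|$$ for every $x \in U$, where $\operatorname{dist}(x,\partial U)$ is the distance from $x$ to the boundary of $U$. The constant $m!/n!$ is exact: equality is achieved by a Möbius transformation (for some open interval $U$, some Möbius transformation $f \in P_d(U)$ and some $x \in U$).
   Context: $D$ denotes differentiation. If $U=\mathbb R$, then $\operatorname{dist}(x,\partial U)=\infty$, with $\infty^{-k}=0$ for $k>0$ and $\infty^0=1$. A Möbius transformation is a rational map of degree $1$. Padé approximants and Schwarzian derivatives: a rational map is a quotient $p/q$ of polynomials with $q \not\equiv 0$; its degree is $\max(\deg p,\deg q)$ when $p,q$ are relatively prime. Let $k \ge 0$ be an integer and $g$ a real-valued function which is $2k$ times differentiable at a real point $y$. The $k$'th Padé approximant to $g$ at $y$, denoted $[g]_y^k$, is the rational map $\mathcal R$ of degree at most $k$ (finite at $y$) with $D^j\mathcal R(y) = D^j g(y)$ for $0 \le j \le 2k$, if such a map exists (it is then unique). If moreover $g$ is $2k+1$ times differentiable at $y$, $Dg(y) \ne 0$, $k\ge 1$, and $\mathcal R = [g]_y^k$ exists, the Schwarzian derivative of order $k$ is $S_k(g)(y) = D^{2k+1}(\mathcal R^{-1}\circ g)(y)$, where $\mathcal R^{-1}$ is the local inverse of $\mathcal R$ sending $g(y)$ to $y$; equivalently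 $S_k(g)(y) = D^{2k+1}(g-\mathcal R)(y)/Dg(y)$. We say $S_k(g)(y)$ exists when $[g]_y^k$ exists. For an open interval $U$, $P_d(U)$ is the set of functions $f:U\to\mathbb R$ which are $2d+1$ times differentiable with $Df \ne 0$ everywhere on $U$ and such that, for every $x\in U$ and $1\le k\le d$, $S_k(f)(x)$ exists and $S_k(f)(x)\ge 0$. *)

(* Defs.v *)
From HB Require Import structures.
From mathcomp Require Export all_boot all_order all_algebra.
From mathcomp Require Export all_classical all_reals all_analysis.
Set Implicit Arguments.
Unset Strict Implicit.
Unset Printing Implicit Defensive.
Export Order.TTheory GRing.Theory Num.Theory.
Export numFieldNormedType.Exports.
Local Open Scope ring_scope.
Local Open Scope classical_set_scope.

(* [n] derivatives exist at the point [y]: those of order less than [n] exist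
   on a neighbourhood of [y], so that [f^`(n.-1)] takes no default values
   there. *)
Fixpoint times_derivable (R : realType) (n : nat) (f : R -> R) (y : R) : Prop :=
  if n is k.+1 then
    (\forall z \near y, times_derivable k f z) /\ derivable f^`(k) y 1
  else True.

(* Rational maps in lowest terms; the numerator and the denominator are thus
   determined up to a common constant factor. *)
Record rational_map (R : fieldType) := RationalMap {
  rnum : {poly R};
  rden : {poly R};
  rden_neq0 : rden != 0;
  rnum_rden_coprime : coprimep rnum rden
}.

(* [size p] is [deg p + 1] if [p != 0], and [rden r != 0]. *)
Definition rdegree (R : fieldType) (r : rational_map R) : nat :=
  (maxn (size (rnum r)) (size (rden r))).-1.

Definition rfinite (R : fieldType) (r : rational_map R) (y : R) : Prop :=
  (rden r).[y] != 0.

(* The value is meaningful only at points where [rfinite] holds. *)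
Definition reval (R : fieldType) (r : rational_map R) (y : R) : R :=
  (rnum r).[y] / (rden r).[y].

Definition is_pade (R : realType) (g : R -> R) (k : nat) (y : R)
    (r : rational_map R) : Prop :=
  [/\ times_derivable (2 * k) g y, (rdegree r <= k)%N, rfinite r y &
      forall j : nat, (j <= 2 * k)%N -> (reval r)^`(j) y = g^`(j) y].

(* [h] is, near [r y], the local inverse of [r] sending [r y] to [y]; the
   first condition gives [h (r y) = y]. *)
Definition is_local_inverse (R : realType) (r h : R -> R) (y : R) : Prop :=
  (\forall z \near y, h (r z) = z) /\ (\forall w \near r y, r (h w) = w).

(* [S_k(g)(y)] exists and equals [s]. A Pade approximant [r] satisfies
   [reval r y = g y], so [h \o g] is defined near [y]; as
   [(reval r)^`() y = g^`() y != 0], the germ of [h] at [g y] exists and is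
   unique. *)
Definition is_schwarzian (R : realType) (k : nat) (g : R -> R) (y s : R) : Prop :=
  [/\ (1 <= k)%N, times_derivable (2 * k).+1 g y, g^`() y != 0 &
      exists (r : rational_map R) (h : R -> R),
        [/\ is_pade g k y r, is_local_inverse (reval r) h y &
            s = (h \o g)^`((2 * k).+1) y]].

(* Functions [U -> R] on an open set [U] are represented by total functions
   constrained on [U] only. *)
Definition P_ (R : realType) (d : nat) (U : set R) : set (R -> R) :=
  [set f | forall x, U x ->
    [/\ times_derivable (2 * d).+1 f x, f^`() x != 0 &
        forall k : nat, (1 <= k <= d)%N ->
          exists s : R, is_schwarzian k f x s /\ 0 <= s]].

Definition open_interval (R : realType) (U : set R) : Prop :=
  open U /\ is_interval U.

Definition boundary (R : realType) (U : set R) : set R :=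
  closure U `\` interior U.

(* The infimum is taken in [\bar R]: the value is [+oo] if the boundary is empty.
   There [(+oo ^+ 0)^-1 = 1] and [(+oo ^+ k.+1)^-1 = 0]. *)
Definition dist_boundary (R : realType) (U : set R) (x : R) : \bar R :=
  edist_inf (boundary U) x.

(* Main.v *)
(* Write a_j = f^(j)(x) / j!, with f' > 0. The Taylor coefficients r_j of the Pade
   approximant p / q of order k satisfy the linear recurrence given by q, so the
   Hankel matrix (r_(i+j+1))_(i,j <= k) is singular, with a kernel vector whose last
   entry is q(x) != 0. It differs from that of the a_j in the last entry only, by a
   positive multiple of S_k(f)(x). By induction on k, S_k(f) >= 0 for k <= d makes
   (a_(i+j+1))_(i,j <= d) positive semidefinite at every point of U. As
   D a_j = (j+1) a_(j+1), this positivity gives differential inequalities which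
   yield r |a_(n+1)| <= a_n and r^2 a_(n+2) <= a_n at x for n odd and
   [x - r, x + r] in U; iterate, and let r tend to the distance to the boundary. *)
Require Import Defs.
From mathcomp Require Import ring zify.
Set Implicit Arguments.
Unset Strict Implicit.
Unset Printing Implicit Defensive.
Local Open Scope ring_scope.
Local Open Scope classical_set_scope.

Section Calculus.
Context {R : realType}.
Implicit Types (f g h : R -> R) (y : R) (n : nat).

Lemma near_eq_derive1 f g y :
  (\forall z \near y, f z = g z) -> \forall z \near y, f^`() z = g^`() z.
Proof.
move=> /near_join fg; near=> z; rewrite !derive1E; apply: near_eq_derive.
by near: z.
Unshelve. all: by end_near. Qed.

Lemma near_eq_derive1n n f g y :
  (\forall z \near y, f z = g z) -> \forall z \near y, f^`(n) z = g^`(n) z.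
Proof.
by move=> fg; elim: n => // n IH; rewrite !derive1nS; exact: near_eq_derive1.
Qed.

(* Contrary to [times_derivable n], all the derivatives up to order [n] exist on
   a neighbourhood of [y], which makes the closure properties go by recursion. *)
Fixpoint near_derivable n f y : Prop :=
  if n is k.+1 then
    (\forall z \near y, derivable f z 1) /\ near_derivable k f^`() y
  else True.

Lemma near_derivable_eq n f g y : (\forall z \near y, f z = g z) ->
  near_derivable n f y -> near_derivable n g y.
Proof.
elim: n f g => //= n IH f g fg [df ndf]; split; last first.
  by apply: IH ndf; exact: near_eq_derive1.
move/near_join : fg => fg; near=> z.
apply: (@near_eq_derivable _ _ _ f); last by near: z.
by near: z.
Unshelve. all: by end_near. Qed.

Lemma near_derivable_leq m n f y : (m <= n)%N ->
  near_derivable n f y -> near_derivable m f y.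
Proof.
elim: n m f => [|n IH] [|m] f //= mn [df ndf].
by split=> //; exact: IH ndf.
Qed.

Lemma near_derivable_derivable n f y : near_derivable n.+1 f y -> derivable f y 1.
Proof. by case=> /nbhs_singleton. Qed.

Lemma near_derivable_continuous n f y :
  near_derivable n.+1 f y -> {for y, continuous f}.
Proof.
move=> ndf; apply/differentiable_continuous/derivable1_diffP.
exact: near_derivable_derivable ndf.
Qed.

Lemma near_derivable_near n f y : near_derivable n f y ->
  \forall z \near y, near_derivable n f z.
Proof.
elim: n f => [|n IH] f /=.
  by move=> _; exact: filterE.
by move=> [/near_join df /IH]; apply: filterS2 df.
Qed.

Lemma derive1D f g z : derivable f z 1 -> derivable g z 1 ->
  (fun z => f z + g z)^`() z = f^`()%classic z + g^`()%classic z.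
Proof. by move=> df dg; rewrite !derive1E; exact: deriveD df dg. Qed.

Lemma derive1M f g z : derivable f z 1 -> derivable g z 1 ->
  (fun z => f z * g z)^`() z = f^`()%classic z * g z + f z * g^`()%classic z.
Proof.
move=> df dg; rewrite !derive1E addrC [X in _ + X]mulrC.
exact: deriveM df dg.
Qed.

Lemma derivable1_comp f g z : derivable f (g z) 1 -> derivable g z 1 ->
  derivable (f \o g) z 1.
Proof.
move=> /derivable1_diffP a /derivable1_diffP b.
by apply/derivable1_diffP; exact: differentiable_comp.
Qed.

Lemma near_derivableD n f g y : near_derivable n f y -> near_derivable n g y ->
  near_derivable n (fun z => f z + g z) y.
Proof.
elim: n f g => [//|n IH] f g [df ndf] [dg ndg].
have E : \forall z \near y,
    f^`()%classic z + g^`()%classic z = (fun z => f z + g z)^`() z.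
  by apply: filterS2 df dg => z a b; rewrite derive1D.
split; first by apply: filterS2 df dg => z a b; exact: derivableD.
exact: near_derivable_eq E (IH _ _ ndf ndg).
Qed.

Lemma near_derivableM n f g y : near_derivable n f y -> near_derivable n g y ->
  near_derivable n (fun z => f z * g z) y.
Proof.
elim: n f g => [//|n IH] f g ndf ndg; have [df ndf'] := ndf.
have [dg ndg'] := ndg.
have E : \forall z \near y,
    f^`()%classic z * g z + f z * g^`()%classic z = (fun z => f z * g z)^`() z.
  by apply: filterS2 df dg => z a b; rewrite derive1M.
split; first by apply: filterS2 df dg => z a b; exact: (derivableM a b).
have wf := near_derivable_leq (leqnSn n) ndf.
have wg := near_derivable_leq (leqnSn n) ndg.
exact: near_derivable_eq E (near_derivableD (IH _ _ ndf' wg) (IH _ _ wf ndg')).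
Qed.

Lemma near_derivableN n f y : near_derivable n f y ->
  near_derivable n (fun z => - f z) y.
Proof.
elim: n f => [//|n IH] f [df ndf].
have E : \forall z \near y, - f^`()%classic z = (fun z => - f z)^`() z.
  by apply: filterS df => z a; rewrite !derive1E deriveN.
split; first by apply: filterS df => z a; exact: derivableN.
exact: near_derivable_eq E (IH _ ndf).
Qed.

Lemma near_derivable_horner n (p : {poly R}) y : near_derivable n (horner p) y.
Proof.
elim: n p => //= n IH p; split; first by apply: filterE => z; exact: derivable_horner.
by rewrite -derivE.
Qed.

Lemma near_neq0 f y : {for y, continuous f} -> f y != 0 ->
  \forall z \near y, f z != 0.
Proof.
by move=> cf fy; exact: cvgr_neq0 cf fy.
Qed.

Lemma near_derivableV n f y : f y != 0 -> near_derivable n f y ->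
  near_derivable n (fun z => (f z)^-1) y.
Proof.
elim: n f => [//|n IH] f fy ndf; have [df ndf'] := ndf.
have fz : \forall z \near y, f z != 0.
  by apply: near_neq0 fy; exact: near_derivable_continuous ndf.
have E : \forall z \near y,
    - (f^`()%classic z * ((f z)^-1 * (f z)^-1)) = (fun z => (f z)^-1)^`() z.
  apply: filterS2 df fz => z a b; rewrite !derive1E deriveV//.
  by rewrite -invfM -expr2 scaleNr mulrC.
split; first by apply: filterS2 df fz => z a b; exact: (derivableV b a).
have ndV := IH _ fy (near_derivable_leq (leqnSn n) ndf).
exact: near_derivable_eq E
  (near_derivableN (near_derivableM ndf' (near_derivableM ndV ndV))).
Qed.

Lemma near_comp (P : set R) g y : {for y, continuous g} ->
  (\forall w \near g y, P w) -> \forall z \near y, P (g z).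
Proof. by move=> cg Py; apply: cg. Qed.

Lemma near_derivable_comp n f g y : near_derivable n g y ->
  near_derivable n f (g y) -> near_derivable n (f \o g) y.
Proof.
elim: n f g => [//|n IH] f g ndg [df ndf]; have [dg ndg'] := ndg.
have df_ : \forall z \near y, derivable f (g z) 1.
  exact: near_comp (near_derivable_continuous ndg) df.
have E : \forall z \near y, ((f^`() \o g) z) * g^`()%classic z = (f \o g)^`() z.
  by apply: filterS2 df_ dg => z a b; rewrite (derive1_comp b a).
split; first by apply: filterS2 df_ dg => z a b; exact: (derivable1_comp a b).
have wg := near_derivable_leq (leqnSn n) ndg.
exact: near_derivable_eq E (near_derivableM (IH _ _ wg ndf) ndg').
Qed.

End Calculus.

Local Opaque derive1.

(** * Taylor coefficients *)

Section Taylor.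
Context {R : realType}.
Implicit Types (f g h : R -> R) (y : R) (n : nat).

Lemma near_derivable_derive1n n f y : near_derivable n f y ->
  (\forall z \near y, derivable f^`(n) z 1) -> near_derivable n.+1 f y.
Proof.
elim: n f => [|n IH] f; first by rewrite derive1n0; split.
move=> [df ndf] dfn; split; first exact: df.
by apply: IH ndf _; rewrite -derive1Sn.
Qed.

Lemma derivable_derive1n n f y : near_derivable n.+1 f y -> derivable f^`(n) y 1.
Proof.
elim: n f => [|n IH] f; first exact: near_derivable_derivable.
by move=> [_ /IH]; rewrite derive1Sn.
Qed.

Lemma near_times_derivable n f y :
  (\forall z \near y, times_derivable n f z) -> near_derivable n f y.
Proof.
elim: n => [//|n IH] td; apply: near_derivable_derive1n.
  by apply: IH; apply: filterS td => z [] /nbhs_singleton.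
by apply: filterS td => z [].
Qed.

Lemma near_derivable_times n f y : near_derivable n f y -> times_derivable n f y.
Proof.
elim: n y => [//|n IH] y ndf; split; last exact: derivable_derive1n.
by apply: filterS (near_derivable_near (near_derivable_leq (leqnSn n) ndf)).
Qed.

Definition taylor f y n : R := derive1n n f y / n`!%:R.

Lemma taylorS f y n : n.+1%:R * taylor f y n.+1 = taylor (derive1 f) y n.
Proof.
rewrite /taylor derive1Sn factS natrM.
by rewrite invfM mulrCA mulVKf// pnatr_eq0.
Qed.

Lemma near_eq_taylor f g y n : (\forall z \near y, f z = g z) ->
  taylor f y n = taylor g y n.
Proof.
by move=> fg; rewrite /taylor (nbhs_singleton (near_eq_derive1n n fg)).
Qed.

Lemma taylor0 f y : taylor f y 0 = f y.
Proof. by rewrite /taylor derive1n0 fact0 divr1. Qed.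

Lemma taylorE f y n : taylor f y n = derive1n n f y / n`!%:R.
Proof. by []. Qed.

Local Opaque taylor.

Lemma taylorD f g y n : near_derivable n f y -> near_derivable n g y ->
  taylor (fun z => f z + g z) y n = taylor f y n + taylor g y n.
Proof.
elim: n f g => [|n IH] f g; first by rewrite !taylor0.
move=> [df ndf] [dg ndg].
apply: (@mulfI _ n.+1%:R); first by rewrite pnatr_eq0.
rewrite mulrDr !taylorS -IH//; apply: near_eq_taylor.
by apply: filterS2 df dg => z a b; rewrite (derive1D a b).
Qed.

Lemma taylorM f g y n : near_derivable n f y -> near_derivable n g y ->
  taylor (fun z => f z * g z) y n =
  \sum_(i < n.+1) taylor f y i * taylor g y (n - i).
Proof.
elim: n f g => [|n IH] f g ndf ndg.
  by rewrite big_ord_recl big_ord0 addr0/= subnn !taylor0.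
have wf := near_derivable_leq (leqnSn n) ndf.
have wg := near_derivable_leq (leqnSn n) ndg.
have [df ndf'] := ndf; have [dg ndg'] := ndg.
apply: (@mulfI _ n.+1%:R); first by rewrite pnatr_eq0.
rewrite taylorS.
rewrite (@near_eq_taylor _ (fun z => derive1 f z * g z + f z * derive1 g z)); last first.
  by apply: filterS2 df dg => z a b; rewrite (derive1M a b).
rewrite taylorD; [|exact: near_derivableM..].
rewrite !IH// mulr_sumr.
transitivity (\sum_(i < n.+2) (i%:R * (taylor f y i * taylor g y (n.+1 - i)) +
  (n.+1 - i)%:R * (taylor f y i * taylor g y (n.+1 - i)))); last first.
  apply: eq_bigr => i _; rewrite -mulrDl -natrD subnKC//.
  by rewrite -ltnS ltn_ord.
rewrite big_split/=; congr (_ + _).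
  rewrite [RHS]big_ord_recl mul0r add0r; apply: eq_bigr => i _.
  by rewrite -taylorS mulrA lift0 subSS.
rewrite [RHS]big_ord_recr/= subnn mul0r addr0; apply: eq_bigr => i _.
by rewrite -taylorS subSn -1?ltnS// mulrCA.
Qed.

Lemma derive1_comp_near n h f y : near_derivable n.+1 h (f y) ->
  near_derivable n.+1 f y ->
  \forall z \near y, (h \o f)^`() z = ((derive1 h \o f) z) * derive1 f z.
Proof.
move=> [dh ndh] ndf; have [df _] := ndf.
have dhf := near_comp (near_derivable_continuous ndf) dh.
by apply: filterS2 df dhf => z a b; rewrite (derive1_comp a b).
Qed.

Lemma taylor_compS n h f y : near_derivable n.+1 h (f y) ->
  near_derivable n.+1 f y ->
  n.+1%:R * taylor (h \o f) y n.+1 =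
  \sum_(i < n.+1) taylor (derive1 h \o f) y i * taylor (derive1 f) y (n - i).
Proof.
move=> ndh ndf; rewrite taylorS.
rewrite (@near_eq_taylor _ (fun z => ((derive1 h \o f) z) * derive1 f z)); last first.
  exact: derive1_comp_near ndh ndf.
have [_ ndf'] := ndf; have [_ ndh'] := ndh.
rewrite taylorM//; apply: near_derivable_comp ndh'.
exact: near_derivable_leq ndf.
Qed.

Lemma taylor_comp_eq n h f1 f2 y :
  near_derivable n h (f1 y) -> near_derivable n f1 y -> near_derivable n f2 y ->
  (forall j, (j <= n)%N -> taylor f1 y j = taylor f2 y j) ->
  taylor (h \o f1) y n = taylor (h \o f2) y n.
Proof.
move=> + + + f12.
have f12y : f1 y = f2 y by have := f12 0%N isT; rewrite !taylor0.
elim/ltn_ind: n h f12 => -[|n] IH h f12 ndh ndf1 ndf2.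
  by rewrite !taylor0/= f12y.
apply: (@mulfI _ n.+1%:R); first by rewrite pnatr_eq0.
rewrite !taylor_compS//; last by rewrite -f12y.
have [_ ndh'] := ndh.
apply: eq_bigr => i _; congr (_ * _).
  have ile : (i <= n)%N by rewrite -ltnS.
  apply: IH; rewrite ?ltnS//.
  - by move=> j ji; apply: f12; rewrite (leq_trans ji)// (leq_trans ile).
  - exact: near_derivable_leq ndh'.
  - by apply: near_derivable_leq ndf1; rewrite (leq_trans ile).
  - by apply: near_derivable_leq ndf2; rewrite (leq_trans ile).
by rewrite -!taylorS f12// ltnS leq_subr.
Qed.

Lemma taylor_comp_diff n h f1 f2 y :
  near_derivable n.+1 h (f1 y) -> near_derivable n.+1 f1 y ->
  near_derivable n.+1 f2 y ->
  (forall j, (j <= n)%N -> taylor f1 y j = taylor f2 y j) ->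
  taylor (h \o f1) y n.+1 - taylor (h \o f2) y n.+1 =
  (derive1 h) (f1 y) * (taylor f1 y n.+1 - taylor f2 y n.+1).
Proof.
move=> ndh ndf1 ndf2 f12.
have f12y : f1 y = f2 y by have := f12 0%N isT; rewrite !taylor0.
apply: (@mulfI _ n.+1%:R); first by rewrite pnatr_eq0.
rewrite mulrBr !taylor_compS//; last by rewrite -f12y.
have [_ ndh'] := ndh.
rewrite -sumrB big_ord_recl big1 => [|i _].
  by rewrite addr0/= !subn0 -!taylorS !taylor0/= -f12y -mulrBr -mulrBr mulrCA.
rewrite lift0.
have -> : taylor (derive1 f1) y (n - i.+1) = taylor (derive1 f2) y (n - i.+1).
  by rewrite -!taylorS f12// subnSK// leq_subr.
have -> : taylor (derive1 h \o f1) y i.+1 = taylor (derive1 h \o f2) y i.+1.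
  have ile : (i.+1 <= n)%N by [].
  apply: taylor_comp_eq.
  - exact: near_derivable_leq ndh'.
  - by apply: near_derivable_leq ndf1; rewrite (leq_trans ile).
  - by apply: near_derivable_leq ndf2; rewrite (leq_trans ile).
  - by move=> j ji; apply: f12; rewrite (leq_trans ji).
by rewrite subrr.
Qed.

End Taylor.

Section LocalInverse.
Context {R : realType}.
Implicit Types (f g h : R -> R) (y : R) (n : nat).

Lemma near_derivable_inverse n f h y :
  near_derivable n.+2 f y -> derive1 f y != 0 ->
  (\forall z \near y, h (f z) = z) -> near_derivable n.+1 h (f y).
Proof.
move=> ndf fy hf.
have df : \forall z \near y, derivable f z 1 := ndf.1.
have ndf' : near_derivable n.+1 (derive1 f) y := ndf.2.
have cf : {near y, continuous f}.
  apply: filterS df => z dfz.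
  exact/differentiable_continuous/derivable1_diffP.
have [ch fh] := near_can_continuousAcan_sym hf cf.
have hfy : h (f y) = y := nbhs_singleton hf.
have chy : {for f y, continuous h} := nbhs_singleton ch.
have near_h (P : set R) : (\forall z \near y, P z) -> \forall w \near f y, P (h w).
  by move=> Py; apply: near_comp chy _; rewrite hfy.
have fz : \forall z \near y, derive1 f z != 0.
  by apply: near_neq0 fy; exact: near_derivable_continuous ndf'.
have Dh : \forall w \near f y, is_derive (w : R) (1 : R) h (derive1 f (h w))^-1.
  have D : \forall z \near y, is_derive (f z) (1 : R) h (derive1 f z)^-1.
    have hf' : \forall z \near y, \forall t \near z, h (f t) = t.
      exact: near_join hf.
    have cf' : \forall z \near y, \forall t \near z, {for t, continuous f}.
      exact: near_join cf.
    have df' : \forall z \near y, derivable f z 1 /\ derive1 f z != 0.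
      by apply: filterS2 df fz.
    apply: filterS3 df' hf' cf' => z [a b] c e.
    apply: is_derive_inverse => //.
    by rewrite derive1E; exact/derivableP.
  have D' : \forall w \near f y, is_derive (f (h w)) (1 : R) h (derive1 f (h w))^-1.
    exact: near_h D.
  have fh' : \forall w \near f y, f (h w) = w by exact: fh.
  by apply: filterS2 fh' D' => w ->.
have dh : \forall w \near f y, derivable h w 1.
  by apply: filterS Dh => w Dw; exact: ex_derive.
have Eh : \forall w \near f y, (derive1 f (h w))^-1 = derive1 h w.
  by apply: filterS Dh => w Dw; rewrite [RHS]derive1E (@derive_val _ _ _ _ _ _ _ Dw).
elim: n ndf ndf' {df} => [|n IH] ndf ndf'; split; [exact: dh|by []|exact: dh|].
have ndh : near_derivable n.+1 h (f y).
  apply: IH; [exact: near_derivable_leq ndf|exact: near_derivable_leq ndf'].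
apply: near_derivable_eq Eh _.
have ndf'h : near_derivable n.+1 (derive1 f) (h (f y)).
  by rewrite hfy; exact: near_derivable_leq ndf'.
apply: near_derivableV; first by rewrite hfy.
exact: (near_derivable_comp ndh ndf'h).
Qed.

End LocalInverse.

(** * Hankel forms *)

Section Hankel.
Context {R : realFieldType}.
Implicit Types (b r v w x : nat -> R) (k n : nat).

Definition hankel b n x : R := \sum_(i < n) \sum_(j < n) x i * x j * b (i + j)%N.

Definition hankel_psd b n : Prop := forall x, 0 <= hankel b n x.

Lemma hankel_recr b n x : x n = 0 -> hankel b n.+1 x = hankel b n x.
Proof.
move=> xn; rewrite /hankel big_ord_recr/= [X in _ + X]big1 => [|j _]; last first.
  by rewrite xn !mul0r.
rewrite addr0; apply: eq_bigr => i _.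
by rewrite big_ord_recr/= xn mulr0 mul0r addr0.
Qed.

Lemma eq_hankel b b' n x : (forall i, (i < n.*2.-1)%N -> b i = b' i) ->
  hankel b n x = hankel b' n x.
Proof.
move=> bb; apply: eq_bigr => i _; apply: eq_bigr => j _; rewrite bb//.
have := ltn_ord i; have := ltn_ord j; case: n i j bb => // n i j _ hj hi.
by rewrite doubleS/= ltnS -addnn leq_add.
Qed.

Lemma hankel_kernel r v k x w t :
  (forall l, (l <= k)%N -> \sum_(i < k.+1) v i * r (i + l)%N = 0) ->
  (forall i, x i = t * v i + w i) -> hankel r k.+1 x = hankel r k.+1 w.
Proof.
move=> vr xE.
have K0 (y : nat -> R) : \sum_(i < k.+1) \sum_(j < k.+1) v i * y j * r (i + j)%N = 0.
  rewrite exchange_big/= big1// => j _.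
  have hj : (j <= k)%N by rewrite -ltnS.
  rewrite -[RHS](mulr0 (y j)) -[in RHS](vr _ hj) mulr_sumr.
  by apply: eq_bigr => i _; ring.
transitivity (hankel r k.+1 w
  + t * (\sum_(i < k.+1) \sum_(j < k.+1) v i * x j * r (i + j)%N)
  + t * (\sum_(i < k.+1) \sum_(j < k.+1) v i * w j * r (i + j)%N)); last first.
  by rewrite !K0 mulr0 !addr0.
rewrite [X in _ + t * X]exchange_big/=.
rewrite !mulr_sumr -!big_split/=; apply: eq_bigr => i _.
rewrite !mulr_sumr -!big_split/=; apply: eq_bigr => j _.
by rewrite !xE (addnC j i); ring.
Qed.

Lemma hankel_corner b r k c x : (forall i, (i < k.*2)%N -> b i = r i) ->
  b k.*2 = r k.*2 + c -> hankel b k.+1 x = hankel r k.+1 x + c * x k ^+ 2.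
Proof.
move=> br bk.
have lt (i j : 'I_k.+1) : (i + j != k.*2)%N -> b (i + j)%N = r (i + j)%N.
  move=> ij; apply: br; rewrite ltn_neqAle ij -addnn leq_add//; rewrite -ltnS//.
rewrite /hankel !big_ord_recr/= -addrA; congr (_ + _).
  apply: eq_bigr => i _; apply: eq_bigr => j _; congr (_ * _).
  have := lt (widen_ord (leqnSn k) i) j; apply => /=.
  by rewrite neq_ltn -addnn -addSn leq_add// -ltnS.
rewrite -addrA; congr (_ + _).
  apply: eq_bigr => j _; congr (_ * _).
  have := lt ord_max (widen_ord (leqnSn k) j); apply => /=.
  by rewrite neq_ltn -addnn ltn_add2l ltn_ord.
by rewrite addnn bk; ring.
Qed.

(* [v] is in the kernel of the Hankel matrix of [r], so modulo [v] the form of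
   [r] reduces to the form of [b] of the previous size. *)
Lemma hankel_psdS b r v k c : (forall i, (i < k.*2)%N -> b i = r i) ->
  b k.*2 = r k.*2 + c -> 0 <= c -> v k != 0 ->
  (forall l, (l <= k)%N -> \sum_(i < k.+1) v i * r (i + l)%N = 0) ->
  hankel_psd b k -> hankel_psd b k.+1.
Proof.
move=> br bk c0 vk vr psd x; rewrite (hankel_corner x br bk).
apply: addr_ge0; last by rewrite mulr_ge0 ?sqr_ge0.
pose w i := x i - x k / v k * v i.
rewrite (@hankel_kernel r v k x w (x k / v k) vr); last by move=> i; rewrite /w; ring.
rewrite hankel_recr; last by rewrite /w mulfVK// subrr.
rewrite -(@eq_hankel b r) => [|i ik]; last first.
  by apply: br; rewrite (leq_trans ik)// leq_pred.
exact: psd.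
Qed.

Lemma hankel_psd_leq b m n : (m <= n)%N -> hankel_psd b n -> hankel_psd b m.
Proof.
elim: n => [|n IH]; first by rewrite leqn0 => /eqP->.
rewrite leq_eqVlt => /predU1P[->//|/IH {}IH psd]; apply: IH => x.
pose x' i := if (i < n)%N then x i else 0.
suff -> : hankel b n x = hankel b n x'.
  by rewrite -hankel_recr ?psd// /x' ltnn.
by apply: eq_bigr => i _; apply: eq_bigr => j _; rewrite /x' !ltn_ord.
Qed.

Lemma hankel_psd_quadratic b n h (p q s : R) : hankel_psd b n -> (h.+2 < n)%N ->
  0 <= p ^+ 2 * b h.*2 + p * q *+ 2 * b h.*2.+1 + (q ^+ 2 + p * s *+ 2) * b h.*2.+2
    + q * s *+ 2 * b h.*2.+3 + s ^+ 2 * b h.*2.+4.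
Proof.
move=> psd /hankel_psd_leq/(_ psd)/(_ (fun i => if i == h then p else
  if i == h.+1 then q else if i == h.+2 then s else 0)).
set x := (fun i => _).
have x0 i : (i < h)%N -> x i = 0.
  by move=> ih; rewrite /x !ltn_eqF// ltnS ltnW// ltnW.
have xp : x h = p by rewrite /x eqxx.
have xq : x h.+1 = q by rewrite /x eqxx gtn_eqF.
have xs : x h.+2 = s by rewrite /x eqxx !gtn_eqF.
have S3 (F : nat -> R) : (forall i, (i < h)%N -> F i = 0) ->
    \sum_(i < h.+3) F i = F h + F h.+1 + F h.+2.
  by move=> F0; rewrite !big_ord_recr/= big1 ?add0r// => i _; exact: F0.
rewrite /hankel.
rewrite (S3 (fun i => \sum_(j < h.+3) x i * x j * b (i + j)%N)); last first.
  by move=> i ih; rewrite big1// => j _; rewrite x0// !mul0r.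
have row i : \sum_(j < h.+3) x i * x j * b (i + j)%N =
    x i * x h * b (i + h)%N + x i * x h.+1 * b (i + h.+1)%N
    + x i * x h.+2 * b (i + h.+2)%N.
  rewrite (S3 (fun j => x i * x j * b (i + j)%N))// => j jh.
  by rewrite (x0 j jh) mulr0 mul0r.
rewrite !row.
rewrite xp xq xs !addSn !addnS !addnn.
by congr (_ <= _); ring.
Qed.

Lemma hankel_psd_linear b n h (p q : R) : hankel_psd b n -> (h.+1 < n)%N ->
  0 <= p ^+ 2 * b h.*2 + p * q *+ 2 * b h.*2.+1 + q ^+ 2 * b h.*2.+2.
Proof.
move=> psd /hankel_psd_leq/(_ psd)/(_ (fun i => if i == h then p else
  if i == h.+1 then q else 0)).
set x := (fun i => _).
have x0 i : (i < h)%N -> x i = 0.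
  by move=> ih; rewrite /x !ltn_eqF// ltnS ltnW// ltnW.
have xp : x h = p by rewrite /x eqxx.
have xq : x h.+1 = q by rewrite /x eqxx gtn_eqF.
have S2 (F : nat -> R) : (forall i, (i < h)%N -> F i = 0) ->
    \sum_(i < h.+2) F i = F h + F h.+1.
  by move=> F0; rewrite !big_ord_recr/= big1 ?add0r// => i _; exact: F0.
rewrite /hankel.
rewrite (S2 (fun i => \sum_(j < h.+2) x i * x j * b (i + j)%N)); last first.
  by move=> i ih; rewrite big1// => j _; rewrite x0// !mul0r.
have row i : \sum_(j < h.+2) x i * x j * b (i + j)%N =
    x i * x h * b (i + h)%N + x i * x h.+1 * b (i + h.+1)%N.
  rewrite (S2 (fun j => x i * x j * b (i + j)%N))// => j jh.
  by rewrite (x0 j jh) mulr0 mul0r.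
rewrite !row.
rewrite xp xq !addSn !addnS !addnn.
by congr (_ <= _); ring.
Qed.

End Hankel.

(** * Pade approximants and Schwarzian derivatives *)

Section Pade.
Context {R : realType}.
Implicit Types (f g h : R -> R) (y : R) (n k : nat) (r : rational_map R).

Lemma derive1n_horner n (p : {poly R}) : derive1n n (horner p) = horner (p^`(n))%R.
Proof. by elim: n => // n IH; rewrite derive1nS IH -derivE derivnS. Qed.

Lemma taylor_horner_eq0 n (p : {poly R}) y : (size p <= n)%N ->
  taylor (horner p) y n = 0.
Proof.
by move=> pn; rewrite taylorE derive1n_horner derivn_poly0// horner0 mul0r.
Qed.

Lemma near_derivable_reval n r y : rfinite r y -> near_derivable n (reval r) y.
Proof.
move=> ry; apply: near_derivableM; first exact: near_derivable_horner.
by apply: near_derivableV => //; exact: near_derivable_horner.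
Qed.

Lemma reval_recurrence r k n y : (rdegree r <= k)%N -> rfinite r y -> (k < n)%N ->
  \sum_(i < k.+1) taylor (horner (rden r)) y i * taylor (reval r) y (n - i) = 0.
Proof.
move=> rk ry kn.
have [sn sd] : (size (rnum r) <= k.+1)%N /\ (size (rden r) <= k.+1)%N.
  apply/andP; rewrite -geq_max; move: rk; rewrite /rdegree.
  by case: (maxn _ _).
have E : \forall z \near y, (rnum r).[z] = (rden r).[z] * reval r z.
  have : \forall z \near y, (rden r).[z] != 0.
    by apply: near_neq0 => //; exact: continuous_horner.
  by apply: filterS => z rz; rewrite /reval mulrC divfK.
have := near_eq_taylor n E; rewrite taylor_horner_eq0; last exact: leq_trans sn kn.
rewrite taylorM; [|exact: near_derivable_horner|exact: near_derivable_reval].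
move=> /esym S0; rewrite -[RHS]S0.
rewrite (big_ord_widen n.+1 (fun i =>
  taylor (horner (rden r)) y i * taylor (reval r) y (n - i))); last by rewrite ltnS ltnW.
rewrite big_mkcond/=; apply: eq_bigr => i _; case: ltnP => // ki.
by rewrite taylor_horner_eq0 ?mul0r// (leq_trans sd).
Qed.

Lemma derive1_inverse n f h y : near_derivable n.+2 f y -> derive1 f y != 0 ->
  (\forall z \near y, h (f z) = z) -> derive1 h (f y) = (derive1 f y)^-1.
Proof.
move=> ndf fy hf.
have ndh := near_derivable_inverse ndf fy hf.
have E : \forall z \near y, (h \o f) z = (id : R -> R) z by exact: hf.
have := nbhs_singleton (near_eq_derive1 E).
rewrite derive1_id derive1_comp; [|exact: near_derivable_derivable ndf
                                  |exact: near_derivable_derivable ndh].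
by move=> hE; apply: (mulIf fy); rewrite hE mulVf.
Qed.

Lemma schwarzian_pade f y s k : near_derivable (2 * k).+1 f y ->
  is_schwarzian k f y s ->
  exists r v : nat -> R,
   [/\ v k != 0, forall i, (i <= 2 * k)%N -> r i = taylor f y i,
       s * derive1 f y = (2 * k).+1`!%:R * (taylor f y (2 * k).+1 - r (2 * k).+1) &
       forall l, (l <= k)%N -> \sum_(i < k.+1) v i * r (i + l).+1 = 0].
Proof.
move=> ndf [k1 _ f'y [r [h [[_ rk ry rf] [hr rh] ->]]]].
have rfE i : (i <= 2 * k)%N -> taylor (reval r) y i = taylor f y i.
  by move=> /rf; rewrite !taylorE => ->.
exists (taylor (reval r) y), (fun i => taylor (horner (rden r)) y (k - i)); split=> //.
- by rewrite subnn taylor0.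
- have r0 : reval r y = f y by have := rf 0%N isT; rewrite !derive1n0.
  have r1 : derive1 (reval r) y = derive1 f y.
    by have := rf 1%N; rewrite !derive1n1; apply; rewrite muln_gt0.
  have r'y : derive1 (reval r) y != 0 by rewrite r1.
  have ndr m : near_derivable m (reval r) y by exact: near_derivable_reval.
  have ndh : near_derivable (2 * k).+1 h (reval r y).
    exact: near_derivable_inverse (ndr _) r'y hr.
  have dh := derive1_inverse (ndr 2%N) r'y hr.
  have := @taylor_comp_diff _ (2 * k) h f (reval r) y.
  rewrite -r0 => /(_ ndh ndf (ndr _)) D.
  have {D} := D (fun j jk => esym (rfE j jk)).
  rewrite (@near_eq_taylor _ (h \o reval r) (horner 'X)); last first.
    by apply: filterS hr => z /= ->; rewrite hornerX.
  rewrite (@taylor_horner_eq0 _ 'X); last by rewrite size_polyX ltnS muln_gt0.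
  rewrite subr0 dh r1 taylorE => E.
  have -> : derive1n (2 * k).+1 (h \o f) y = (derive1 f y)^-1 *
    (taylor f y (2 * k).+1 - taylor (reval r) y (2 * k).+1) * (2 * k).+1`!%:R.
    by rewrite -E divfK// pnatr_eq0 -lt0n fact_gt0.
  by field.
move=> l lk; have kl : (k < (k + l).+1)%N by rewrite ltnS leq_addr.
rewrite -[RHS](reval_recurrence rk ry kl) (reindex_inj rev_ord_inj)/=.
apply: eq_bigr => i _; have ik : (i <= k)%N by rewrite -ltnS.
by rewrite subSS subKn// subSn ?(leq_trans ik) ?leq_addr// addnBAC.
Qed.

End Pade.

Section RealDerivatives.
Context {R : realType}.
Implicit Types (f g df : R -> R) (x y z a b : R) (U : set R).

Lemma is_derive_add f g z a b : is_derive z (1 : R) f a -> is_derive z (1 : R) g b ->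
  is_derive z (1 : R) (fun y => f y + g y) (a + b).
Proof. by move=> fa gb; exact: is_deriveD. Qed.

Lemma is_derive_mul f g z a b : is_derive z (1 : R) f a -> is_derive z (1 : R) g b ->
  is_derive z (1 : R) (fun y => f y * g y) (a * g z + f z * b).
Proof.
move=> fa gb; rewrite addrC [X in _ + X]mulrC; exact: is_deriveM.
Qed.

Lemma is_derive_shift c z : is_derive z (1 : R) (fun y => y - c) 1.
Proof.
have := is_derive_add (@is_derive_id _ _ z 1) (@is_derive_cst _ _ _ (- c) z 1).
by rewrite addr0.
Qed.

Lemma is_derive_shiftX c z n :
  is_derive z (1 : R) (fun y => (y - c) ^+ n.+1) (n.+1%:R * (z - c) ^+ n).
Proof.
elim: n => [|n IH]; first by rewrite expr0 mulr1; exact: is_derive_shift.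
have := is_derive_mul (is_derive_shift c z) IH.
rewrite (_ : 1 * _ + _ = n.+2%:R * (z - c) ^+ n.+1); last first.
  by rewrite [n.+2%:R]mulrS exprS; ring.
by congr is_derive; apply/funext => y; rewrite [RHS]exprS.
Qed.

Lemma is_derive_ge0_le U f df x y : is_interval U ->
  (forall z, U z -> is_derive z (1 : R) f (df z)) ->
  (forall z, U z -> 0 <= df z) -> U x -> U y -> x <= y -> f x <= f y.
Proof.
move=> iU fD df0 Ux Uy xy.
have UI z : z \in `[x, y]%R -> U z.
  by rewrite in_itv/= => xzy; exact: iU xzy.
have [||c cxy] := @MVT_segment R f df x y xy.
- by move=> z zxy; apply/fD/UI/subset_itv_oo_cc.
- apply: derivable_within_continuous => z /UI Uz.
  exact: (@ex_derive _ _ _ _ _ _ _ (fD _ Uz)).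
move=> fE; rewrite -subr_ge0 fE mulr_ge0 ?subr_ge0//.
exact/df0/UI.
Qed.

Lemma deriv2_ge0_at_min f df a b c l :
  (forall z, z \in `]a, b[%R -> is_derive z (1 : R) f (df z)) ->
  c \in `]a, b[%R -> (forall z, z \in `]a, b[%R -> f c <= f z) ->
  is_derive c (1 : R) df l -> 0 <= l.
Proof.
move=> fD cab fmin dfl; rewrite leNgt; apply/negP => l0.
have [ac cb] : a < c /\ c < b by move: cab; rewrite in_itv/= => /andP.
have dfc : df c = 0.
  have := @derive1_at_min _ f a b c (ltW (lt_trans ac cb)) _ cab fmin.
  move=> /(_ (fun z zab => @ex_derive _ _ _ _ _ _ _ (fD z zab))) fc0.
  by rewrite -(@derive_val _ _ _ _ _ _ _ (fD _ cab)) (@derive_val _ _ _ _ _ _ _ fc0).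
have : \forall h \near (0 : R)^', h^-1 * df (h + c) < 0.
  have [+ dl] := dfl; rewrite /derivable -/('D_1 df c) dl => cv.
  have lt0 : \forall h \near (0 : R)^', h^-1 *: (df (h *: (1 : R) + c) - df c) < 0.
    exact: cvgr_lt _ cv _ l0.
  apply: filterS lt0 => h; rewrite dfc subr0.
  by rewrite -[h *: 1]/(h * 1) mulr1.
move=> /nbhs_ex[e He].
pose h := Num.min (e%:num) (b - c) / 2.
have h0 : 0 < h by rewrite divr_gt0// lt_min subr_gt0 cb andbT.
have hm : h < Num.min (e%:num) (b - c).
  by rewrite ltr_pdivrMr// ltr_pMr ?ltr1n// lt_min subr_gt0 cb andbT.
have [he hbc] : h < e%:num /\ h < b - c by move: hm; rewrite lt_min => /andP.
have sub z : z \in `[c, c + h]%R -> z \in `]a, b[%R.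
  rewrite !in_itv/= => /andP[cz zh]; rewrite (lt_le_trans ac)//=.
  by rewrite (le_lt_trans zh)// addrC -ltrBrDr.
have cch : c < c + h by rewrite ltrDl.
have fDc z : z \in `]c, (c + h)[%R -> is_derive z (1 : R) f (df z).
  by move=> zch; apply/fD/sub/subset_itv_oo_cc.
have fcc : {within `[c, c + h], continuous f}.
  apply: derivable_within_continuous => z zch.
  exact: (@ex_derive _ _ _ _ _ _ _ (fD _ (sub _ zch))).
have [z zch fE] := MVT cch fDc fcc.
have [cz zh] : c < z /\ z < c + h by move: zch; rewrite in_itv/= => /andP.
have fle : f c <= f (c + h) by apply/fmin/sub; rewrite in_itv/= lexx ltW.
have zc0 : 0 < z - c by rewrite subr_gt0.
have dfz : (z - c)^-1 * df (z - c + c) < 0.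
  apply: He; last by rewrite gt_eqF.
  rewrite /ball/= sub0r normrN gtr0_norm// (lt_trans _ he)// ltrBlDr addrC//.
rewrite subrK pmulr_rlt0 ?invr_gt0// in dfz.
have : 0 <= df z * (c + h - c) by rewrite -fE subr_ge0.
by rewrite addrAC subrr add0r pmulr_lge0// leNgt dfz.
Qed.

End RealDerivatives.

(** * Estimates for positive Hankel forms *)

Section Estimates.
Context {R : realType}.
Variables (U : set R) (d : nat) (a : nat -> R -> R).
Hypothesis iU : is_interval U.
Hypothesis aD : forall j x, U x -> (j <= 2 * d)%N ->
  is_derive x (1 : R) (a j) (j.+1%:R * a j.+1 x).
Hypothesis a_psd : forall x, U x -> hankel_psd (fun i => a i.+1 x) d.+1.

Let quadratic n x p q : U x -> odd n -> (n < 2 * d)%N ->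
  0 <= p ^+ 2 * a n x + p * q *+ 2 * a n.+1 x + q ^+ 2 * a n.+2 x.
Proof.
move=> Ux on nd; have nE : n = n./2.*2.+1 by rewrite -{1}(odd_double_half n) on.
have := @hankel_psd_linear _ _ _ n./2 p q (a_psd Ux); rewrite -nE; apply.
by lia.
Qed.

Lemma coef_ge0 n x : U x -> odd n -> (n < 2 * d)%N -> 0 <= a n x.
Proof.
move=> Ux on nd; have := quadratic 1 0 Ux on nd.
by rewrite expr1n expr0n/= !mul1r !mul0r mul0rn mul0r !addr0.
Qed.

(* With [p y := a n y - (c - y) * a n.+1 y], positivity of the quadratic form at
   [1 - (c - y) X] reads [(c - y) * p' y <= n.+2 * p y], that is, the function
   [(y - c) ^+ n.+2 * p y], which vanishes at [c], is nondecreasing. *)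
Lemma coefS_le n x c : U x -> U c -> odd n -> (n < 2 * d)%N ->
  (c - x) * a n.+1 x <= a n x.
Proof.
move=> Ux Uc on nd.
pose p y := a n y + (y - c) * a n.+1 y.
pose dp y := n.+2%:R * (a n.+1 y + (y - c) * a n.+2 y).
have pD y : U y -> is_derive y (1 : R) p (dp y).
  move=> Uy; have D1 := aD Uy (ltnW nd); have D2 := aD Uy nd.
  have := is_derive_add D1 (is_derive_mul (is_derive_shift c y) D2).
  by congr is_derive; rewrite /dp [n.+2%:R]mulrS; ring.
pose F y := (y - c) ^+ n.+2 * p y.
pose dF y := (y - c) ^+ n.+1 * (n.+2%:R * p y + (y - c) * dp y).
have FD y : U y -> is_derive y (1 : R) F (dF y).
  move=> Uy; have := is_derive_mul (is_derive_shiftX c y n.+1) (pD _ Uy).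
  by congr is_derive; rewrite /dF [(y - c) ^+ n.+2]exprS; ring.
have dF0 y : U y -> 0 <= dF y.
  move=> Uy; rewrite /dF mulr_ge0//; first by rewrite exprn_even_ge0//= on.
  have := quadratic 1 (y - c) Uy on nd; rewrite /p /dp => h.
  rewrite (_ : _ + _ = n.+2%:R * (1 ^+ 2 * a n y + 1 * (y - c) *+ 2 * a n.+1 y +
    (y - c) ^+ 2 * a n.+2 y)); last by ring.
  by rewrite mulr_ge0.
have Fc : F c = 0 by rewrite /F subrr exprS mul0r mul0r.
suff : 0 <= p x by rewrite /p => h; rewrite -subr_ge0; move: h; congr (_ <= _); ring.
have [cx|xc|<-] := ltgtP c x.
- have := is_derive_ge0_le iU FD dF0 Uc Ux (ltW cx); rewrite Fc pmulr_rge0//.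
  by rewrite exprn_gt0// subr_gt0.
- have := is_derive_ge0_le iU FD dF0 Ux Uc (ltW xc); rewrite Fc nmulr_rle0//.
  by rewrite exprn_odd_lt0 ?subr_lt0//= negbK.
by rewrite /p subrr mul0r addr0; exact: coef_ge0.
Qed.

(* The right-hand side is nonnegative at [c1] and [c2] by [coefS_le]. At an interior
   minimum its first derivative vanishes and its second one is nonnegative; were
   the minimum negative, the form would be negative at [(1 - (c1 - x) X) (1 - (c2 - x) X)]. *)
Lemma coef_quadratic_ge0 n x c1 c2 : U c1 -> U c2 -> c1 <= x <= c2 ->
  odd n -> (n.+2 < 2 * d)%N ->
  0 <= a n x - ((c1 - x) + (c2 - x)) * a n.+1 x + (c1 - x) * (c2 - x) * a n.+2 x.
Proof.
move=> U1 U2 x12 on nd.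
pose comb n x := a n x + ((x - c1) + (x - c2)) * a n.+1 x
  + (x - c1) * (x - c2) * a n.+2 x.
suff : 0 <= comb n x by congr (_ <= _); rewrite /comb; ring.
have combD m y : U y -> (m.+2 <= 2 * d)%N ->
    is_derive y (1 : R) (comb m) (m.+3%:R * comb m.+1 y).
  move=> Uy md.
  have D0 := aD Uy (ltnW (ltnW md)); have D1 := aD Uy (ltnW md); have D2 := aD Uy md.
  have S1 := is_derive_shift c1 y; have S2 := is_derive_shift c2 y.
  have := is_derive_add (is_derive_add D0 (is_derive_mul (is_derive_add S1 S2) D1))
    (is_derive_mul (is_derive_mul S1 S2) D2).
  by congr is_derive; rewrite /comb [m.+3%:R]mulrS [m.+2%:R]mulrS; ring.
have UI y : y \in `[c1, c2]%R -> U y by rewrite in_itv/=; exact: iU.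
have c12 : c1 <= c2 by move: x12 => /andP[]; exact: le_trans.
have cont : {within `[c1, c2], continuous (comb n)}.
  apply: derivable_within_continuous => y /UI Uy.
  exact: (@ex_derive _ _ _ _ _ _ _ (combD n y Uy (ltnW nd))).
have [c ccc cmin] := EVT_min c12 cont.
have xI : x \in `[c1, c2]%R by rewrite in_itv.
suff : 0 <= comb n c by move/le_trans; apply; exact: cmin.
rewrite leNgt; apply/negP => neg.
have nd' : (n < 2 * d)%N := ltnW (ltnW nd).
have endpoint e1 e2 : U e1 -> U e2 ->
    0 <= a n e1 + ((e1 - e1) + (e1 - e2)) * a n.+1 e1 + (e1 - e1) * (e1 - e2) * a n.+2 e1.
  move=> Ue1 Ue2; have := coefS_le Ue1 Ue2 on nd'; rewrite -subr_ge0.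
  by congr (_ <= _); ring.
have n1 : c != c1.
  by apply/eqP => E; move: neg; rewrite E ltNge /comb endpoint.
have n2 : c != c2.
  apply/eqP => E; move: neg; rewrite E ltNge /comb => /negP; apply.
  by have := endpoint _ _ U2 U1; congr (_ <= _); ring.
have [c1c cc2] : c1 < c /\ c < c2.
  by move: ccc; rewrite in_itv/= => /andP[h1 h2]; rewrite !lt_neqAle h1 h2 n2 eq_sym n1.
have coo : c \in `]c1, c2[%R by rewrite in_itv/= c1c.
have Uc := UI _ ccc.
have Doo y : y \in `]c1, c2[%R -> is_derive y (1 : R) (comb n) (n.+3%:R * comb n.+1 y).
  by move=> /subset_itv_oo_cc/UI Uy; exact: combD Uy (ltnW nd).
have minoo y : y \in `]c1, c2[%R -> comb n c <= comb n y.
  by move=> /subset_itv_oo_cc; exact: cmin.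
have Q1 : comb n.+1 c = 0.
  have := @derive1_at_min _ _ c1 c2 c c12 _ coo minoo.
  move=> /(_ (fun z zab => @ex_derive _ _ _ _ _ _ _ (Doo z zab))) D0.
  have := @derive_val _ _ _ _ _ _ _ (Doo _ coo).
  rewrite (@derive_val _ _ _ _ _ _ _ D0) => /esym/eqP.
  by rewrite mulf_eq0 pnatr_eq0/= => /eqP.
have Q2 : 0 <= comb n.+2 c.
  have D2 := is_derive_mul (@is_derive_cst _ _ _ (n.+3%:R : R) c 1) (combD n.+1 c Uc nd).
  have := deriv2_ge0_at_min Doo coo minoo D2.
  by rewrite mul0r add0r !pmulr_rge0.
have nE : n = n./2.*2.+1 by rewrite -{1}(odd_double_half n) on.
have nd2 : (n./2.+2 < d.+1)%N by move: nd nE; clear; lia.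
have := @hankel_psd_quadratic _ _ _ n./2 1 ((c - c1) + (c - c2))
  ((c - c1) * (c - c2)) (a_psd Uc) nd2.
rewrite /= -nE.
move=> pos.
have : 0 <= comb n c + ((c - c1) + (c - c2)) * comb n.+1 c +
    (c - c1) * (c - c2) * comb n.+2 c.
  by move: pos; congr (_ <= _); rewrite /comb; ring.
rewrite Q1 mulr0 addr0 leNgt => /negP; apply.
rewrite -[ltRHS]addr0 ltr_leD// mulr_le0_ge0//.
by rewrite mulr_ge0_le0 ?subr_ge0 ?subr_le0 ?ltW.
Qed.

Lemma coef_ball_le x r m n : U (x - r) -> U (x + r) -> 0 <= r -> odd n ->
  (n <= m <= 2 * d)%N ->
  r ^+ (m - n) * `|a m x| <= a n x.
Proof.
move=> U1 U2 r0 on /andP[nm md].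
have Ux : U x by apply: (iU U1 U2); rewrite gerBl lerDl r0.
move: (m - n)%N (subnKC nm) => k mE; rewrite -mE in md *.
elim/ltn_ind: k n on {mE nm} md => -[|[|k]] IH n on nd.
- by rewrite addn0 expr0 mul1r ger0_norm// coef_ge0//; lia.
- have nd' : (n < 2 * d)%N by lia.
  rewrite addn1 expr1 -{1}(ger0_norm r0) -normrM ler_norml lerNl.
  have := coefS_le Ux U1 on nd'; have := coefS_le Ux U2 on nd'.
  rewrite [x + r]addrC addrK addrAC subrr add0r mulNr => -> ->//.
have nd2 : (n.+2 + k <= 2 * d)%N by lia.
have onS : odd n.+2 by rewrite /= negbK.
have := IH k (ltnW (ltnSn _)) n.+2 onS nd2.
rewrite (_ : (n + k.+2)%N = (n.+2 + k)%N); last by rewrite !addnS !addSn.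
move=> IHk; rewrite -addn2 exprD mulrAC (le_trans (ler_wpM2r _ IHk)) ?sqr_ge0//.
have x12 : x - r <= x <= x + r by rewrite gerBl lerDl r0.
have nd3 : (n.+2 < 2 * d)%N by lia.
have := coef_quadratic_ge0 U1 U2 x12 on nd3.
rewrite -[_ <= a n x]subr_ge0; by congr (_ <= _); ring.
Qed.

End Estimates.

Section Boundary.
Context {R : realType}.
Implicit Types (U : set R) (x y e : R).

Lemma dist_boundary_le U x y : open U -> U x -> ~ U y ->
  (dist_boundary U x <= `|y - x|%:E)%E.
Proof.
move=> oU Ux Uy; pose g (t : R) := x + t * (y - x).
have cg : continuous g.
  move=> t; apply: cvgD; first exact: cvg_cst.
  by apply: cvgM; [exact: cvg_id|exact: cvg_cst].
pose S : set R := [set t | 0 <= t <= 1 /\ U (g t)].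
have S0 : S 0 by split; [rewrite lexx ler01|rewrite /g mul0r addr0].
have ubS : has_ubound S by exists 1 => t [] /andP[].
pose t0 := sup S.
have t00 : 0 <= t0 by exact: (ub_le_sup ubS S0).
have t01 : t0 <= 1 by apply: ge_sup; [exists 0|move=> t [] /andP[]].
have clU : closure U (g t0).
  move=> B Bg; have [t [[_ Ut] Bt]] := closure_sup (ex_intro _ _ S0) ubS (cg _ _ Bg).
  by exists (g t).
have nU : ~ U (g t0).
  move=> Ut0.
  have t0lt1 : t0 < 1.
    rewrite lt_neqAle t01 andbT; apply/eqP => t0E.
    by apply: Uy; move: Ut0; rewrite /g t0E mul1r addrC subrK.
  have : \forall t \near t0, U (g t).
    by apply: near_comp (cg t0) _; exact: open_nbhs_nbhs.
  move=> /nbhs_ex[eps He].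
  pose h := Num.min eps%:num (1 - t0) / 2.
  have m0 : 0 < Num.min eps%:num (1 - t0) by rewrite lt_min subr_gt0 t0lt1 andbT.
  have h0 : 0 < h by rewrite divr_gt0.
  have hm : h < Num.min eps%:num (1 - t0) by rewrite ltr_pdivrMr// ltr_pMr// ltr1n.
  have [he h1] : h < eps%:num /\ h < 1 - t0 by move: hm; rewrite lt_min => /andP.
  have : S (t0 + h).
    split; first by rewrite addr_ge0 ?(ltW h0)//= addrC -lerBrDr ltW.
    by apply: He; rewrite /ball/= opprD addrA subrr add0r normrN gtr0_norm.
  by move=> /(ub_le_sup ubS); rewrite gerDl leNgt h0.
have bd : boundary U (g t0) by split=> // /interior_subset.
apply/lee_addgt0Pr => e e0; apply: ge_ereal_inf.
exists (edist (x, g t0)); first by exists (g t0).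
rewrite -EFinD; apply: edist_fin; first by rewrite ltr_wpDl.
rewrite /ball/= /g opprD addrA subrr add0r normrN normrM (ger0_norm t00).
by rewrite (le_lt_trans (ler_piMl _ t01))// ltrDl.
Qed.

Lemma le_dist_boundary U x e : open U -> (forall y, `|x - y| < e -> U y) ->
  (e%:E <= dist_boundary U x)%E.
Proof.
move=> oU eU; apply: le_ereal_inf_tmp => _ [b [_ nb] <-].
rewrite leNgt; apply/negP => /edist_lt_ball bxe; apply: nb.
by rewrite ((interior_id U).1 oU); exact: eU.
Qed.

End Boundary.

Section Positive.
Context {R : realType}.
Implicit Types (U : set R) (f : R -> R) (x y : R) (d : nat).

Lemma P_near_derivable d U f x : open U -> P_ d U f -> U x ->
  near_derivable (2 * d).+1 f x.
Proof.
move=> oU Pf Ux; apply: near_times_derivable.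
have : \forall z \near x, U z by exact: open_nbhs_nbhs.
by apply: filterS => z /Pf[].
Qed.

Lemma continuous_neq0_mul_gt0 U (g : R -> R) x y : is_interval U ->
  (forall z, U z -> {for z, continuous g}) -> (forall z, U z -> g z != 0) ->
  U x -> U y -> 0 < g x * g y.
Proof.
move=> iU cg g0.
wlog xy : x y / x <= y.
  move=> W Ux Uy; have [xy|/ltW yx] := leP x y; first exact: W.
  by rewrite mulrC; exact: W.
move=> Ux Uy; rewrite ltNge; apply/negP => gxy.
have UI z : z \in `[x, y]%R -> U z.
  by rewrite in_itv/= => xzy; exact: iU xzy.
have cont : {within `[x, y], continuous g}.
  by apply: continuous_in_subspaceT => z; rewrite inE => /UI; exact: cg.
have [|z /UI Uz gz] := @IVT R g x y 0 xy cont.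
  rewrite ge_min le_max; have [gx|gx] := leP (g x) 0 => /=.
    have [gy|gy] := ltP (g y) 0; last by rewrite orbT.
    move: gx; rewrite le_eqVlt (negbTE (g0 _ Ux))/= => gx.
    by move: gxy; rewrite leNgt nmulr_rgt0// gy.
  by rewrite (ltW gx)/= andbT; move: gxy; rewrite pmulr_rle0.
by move: (g0 _ Uz); rewrite gz eqxx.
Qed.

Lemma P_hankel_psd d U f x s : open U -> P_ d U f -> U x -> 0 < s * derive1 f x ->
  forall k, (k <= d)%N -> hankel_psd (fun i => s * taylor f x i.+1) k.+1.
Proof.
move=> oU Pf Ux sf.
have f1 : taylor f x 1 = derive1 f x by rewrite taylorE derive1n1 factS fact0 divr1.
have psd0 : hankel_psd (fun i => s * taylor f x i.+1) 1.
  move=> v; rewrite /hankel !big_ord_recl !big_ord0 !addr0/= f1.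
  by rewrite mulr_ge0 ?(ltW sf)// -expr2 sqr_ge0.
elim=> [//|k IH] kd.
have ndf : near_derivable (2 * k.+1).+1 f x.
  by apply: near_derivable_leq (P_near_derivable oU Pf Ux); lia.
have [_ _ /(_ k.+1 kd)[t [St t0]]] := Pf _ Ux.
have [r [v [vk rE tE vr]]] := schwarzian_pade ndf St.
have E i : (i < k.+1.*2)%N -> s * taylor f x i.+1 = s * r i.+1.
  by move=> ik; rewrite rE//; lia.
apply: (@hankel_psdS _ _ (fun i => s * r i.+1) v k.+1
  (s * (t * derive1 f x) / (2 * k.+1).+1`!%:R) E) => //.
- rewrite -mul2n tE; field.
  by rewrite pnatr_eq0 -lt0n fact_gt0.
- by rewrite divr_ge0// mulrCA mulr_ge0// ltW.
- move=> l lk; transitivity (s * \sum_(i < k.+2) v i * r (i + l).+1); last first.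
    by rewrite vr// mulr0.
  by rewrite mulr_sumr; apply: eq_bigr => i _; rewrite mulrCA.
- exact: IH (ltnW kd).
Qed.

Lemma P_taylor_le d U f x r m n : open_interval U -> P_ d U f ->
  U (x - r) -> U (x + r) -> 0 <= r -> odd n -> (n <= m <= 2 * d)%N ->
  r ^+ (m - n) * `|taylor f x m| <= `|taylor f x n|.
Proof.
move=> [oU iU] Pf U1 U2 r0 on nm.
have Ux : U x by apply: (iU _ _ U1 U2); rewrite gerBl lerDl r0.
have nd y : U y -> near_derivable (2 * d).+1 f y by exact: P_near_derivable.
pose s := Num.sg (derive1 f x).
have f0 y : U y -> derive1 f y != 0 by move=> /Pf[].
have d0 : (0 < 2 * d)%N by lia.
have sf y : U y -> 0 < s * derive1 f y.
  move=> Uy; rewrite -sgr_gt0 sgrM sgr_id -sgrM sgr_gt0.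
  apply: (continuous_neq0_mul_gt0 iU _ f0 Ux Uy) => z Uz.
  have /= [_ ndz] := nd z Uz.
  by apply: (@near_derivable_continuous _ (2 * d).-1); rewrite prednK.
have s1 : `|s| = 1 by rewrite normr_sg f0.
have := @coef_ball_le R U d (fun j y => s * taylor f y j) iU.
move=> /(_ _ _ x r m n U1 U2 r0 on nm).
rewrite normrM s1 mul1r => H; apply: le_trans (H _ _) _.
- move=> j y Uy jd.
  have Dj : is_derive y (1 : R) (derive1n j f) (derive1n j.+1 f y).
    rewrite derive1nS derive1E; apply/derivableP/derivable_derive1n.
    by apply: near_derivable_leq (nd _ Uy); lia.
  have := is_derive_mul (@is_derive_cst _ _ _ (s / j`!%:R) y 1) Dj.
  rewrite mul0r add0r (_ : s / j`!%:R * derive1n j.+1 f y =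
    j.+1%:R * (s * taylor f y j.+1)).
    by congr is_derive; apply/funext => z; rewrite taylorE mulrAC mulrA.
  by rewrite [RHS]mulrCA taylorS taylorE -derive1Sn mulrAC mulrA.
- by move=> y Uy; exact: P_hankel_psd oU Pf Uy (sf _ Uy) _ _.
by rewrite (le_trans (ler_norm _))// normrM s1 mul1r.
Qed.

End Positive.

Section Bound.
Context {R : realType}.
Implicit Types (U : set R) (f : R -> R) (x y : R) (d : nat).

Lemma le_expM_left (b c e : R) k : 0 < e ->
  (forall r, 0 <= r -> r < e -> r ^+ k * c <= b) -> e ^+ k * c <= b.
Proof.
move=> e0 H; rewrite leNgt; apply/negP => lt.
have cv := @continuous_horner _ (c *: 'X^k) e.
have : \forall r \near e, b < (c *: 'X^k).[r].
  by apply: (cvgr_gt _ cv); rewrite !hornerE mulrC.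
move=> /nbhs_ex[eps He].
pose h := Num.min eps%:num e / 2.
have m0 : 0 < Num.min eps%:num e by rewrite lt_min e0 andbT.
have h0 : 0 < h by rewrite divr_gt0.
have hm : h < Num.min eps%:num e by rewrite ltr_pdivrMr// ltr_pMr// ltr1n.
have [he h1] : h < eps%:num /\ h < e by move: hm; rewrite lt_min => /andP.
have : b < (c *: 'X^k).[e - h].
  by apply: He; rewrite /ball/= opprB addrC subrK gtr0_norm.
rewrite !hornerE mulrC ltNge H//; first by rewrite subr_ge0 ltW.
by rewrite gtrBl.
Qed.

Lemma eq0_of_expM_le (b c : R) k : 0 <= c -> (0 < k)%N ->
  (forall r, 0 <= r -> r ^+ k * c <= b) -> c = 0.
Proof.
move=> c0 k0 H; apply/eqP/negPn/negP => cn0.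
have cgt0 : 0 < c by rewrite lt_neqAle eq_sym cn0.
have b0 : 0 <= b by apply: le_trans (H 0 (lexx _)); rewrite expr0n gtn_eqF// mul0r.
pose r := 1 + b / c.
have r1 : 1 <= r by rewrite lerDl divr_ge0.
have := H r (le_trans ler01 r1); rewrite leNgt => /negP; apply.
rewrite (@lt_le_trans _ _ (r * c))//; first by rewrite mulrDl divfK// mul1r ltrDr.
by rewrite ler_wpM2r// ler_eXnr.
Qed.

Lemma expeyS k : (+oo ^+ k.+1 = +oo :> \bar R)%E.
Proof. by elim: k => [|k IH]; rewrite ?expe1// expeS IH mulyy. Qed.

Lemma P_derive1n_le d m n U f x : odd n -> (n <= m <= 2 * d)%N ->
  open_interval U -> P_ d U f -> U x ->
  (`|derive1n m f x|%:E <=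
    (m`!%:R / n`!%:R)%:E * (dist_boundary U x ^+ (m - n))^-1
      * `|derive1n n f x|%:E)%E.
Proof.
move=> on nm UI Pf Ux; have [oU iU] := UI.
set D := dist_boundary U x.
have fact_neq0 j : j`!%:R != 0 :> R by rewrite pnatr_eq0 -lt0n fact_gt0.
have normE j : `|derive1n j f x| = j`!%:R * `|taylor f x j|.
  by rewrite taylorE normrM mulrC normrV ?unitfE// normr_nat divfK.
have H r : 0 <= r -> (r%:E < D)%E -> r ^+ (m - n) * `|taylor f x m| <= `|taylor f x n|.
  move=> r0 rD; have inU z : `|z - x| = r -> U z.
    move=> zr; apply/not_notP => Uz; move: rD; apply/negP; rewrite -leNgt -zr.
    exact: dist_boundary_le.
  apply: (P_taylor_le UI Pf _ _ r0 on nm); apply: inU.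
    by rewrite addrAC subrr add0r normrN ger0_norm.
  by rewrite addrAC subrr add0r ger0_norm.
have [e e0 eD] : exists2 e : R, 0 < e & (e%:E <= D)%E.
  have /nbhs_ex[e He] : nbhs x U by exact: open_nbhs_nbhs.
  by exists e%:num => //; apply: le_dist_boundary => // y xy; exact: He.
rewrite !normE.
have [k0|k0] := posnP (m - n)%N.
  have -> : m = n by lia.
  by rewrite subnn expe0 inve1 mule1 divff// mul1e.
have De : (0 < D)%E by apply: lt_le_trans eD; rewrite lte_fin.
case: D De H {eD} => [delta| |]//.
  rewrite lte_fin => delta0 H.
  have le_delta := le_expM_left delta0 (fun r r0 rd => H r r0 rd).
  have dk0 : 0 < delta ^+ (m - n) by rewrite exprn_gt0.
  rewrite -EFin_expe inver gt_eqF// -!EFinM lee_fin.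
  rewrite (_ : _ * (n`!%:R * _) = m`!%:R * (`|taylor f x n| / delta ^+ (m - n))).
    by rewrite ler_wpM2l// ler_pdivlMr// mulrC.
  by field; rewrite gt_eqF//=.
move=> _ H; rewrite (_ : taylor f x m = 0).
  by rewrite normr0 mulr0 -(prednK k0) expeyS invey mule0 mul0e.
apply/normr0_eq0/(@eq0_of_expM_le `|taylor f x n| _ (m - n)) => // r r0.
by apply: H => //; rewrite ltry.
Qed.

End Bound.

(** * The extremal map 1 / (1 - z) *)

Section Moebius.
Context {R : realType}.
Implicit Types (y : R).

Lemma size_one_sub_X : size (1 - 'X : {poly R}) = 2%N.
Proof. by rewrite -opprB size_polyN -polyC1 size_XsubC. Qed.

Lemma one_sub_X_neq0 : (1 - 'X : {poly R}) != 0.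
Proof. by rewrite -size_poly_eq0 size_one_sub_X. Qed.

Definition moebius : rational_map R :=
  RationalMap one_sub_X_neq0 (coprime1p (1 - 'X)).

Lemma rdegree_moebius : rdegree moebius = 1%N.
Proof. by rewrite /rdegree/= size_one_sub_X size_poly1. Qed.

Lemma reval_moebius y : reval moebius y = (1 - y)^-1.
Proof. by rewrite /reval/= !hornerE. Qed.

Lemma rfinite_moebius y : y < 1 -> rfinite moebius y.
Proof. by rewrite /rfinite/= !hornerE subr_eq0 => y1; rewrite gt_eqF. Qed.

Lemma taylor_moebiusS y n : y < 1 ->
  (1 - y) * taylor (reval moebius) y n.+1 = taylor (reval moebius) y n.
Proof.
move=> y1; have fy := rfinite_moebius y1.
have E : \forall z \near y, (1 : {poly R}).[z] = (1 - 'X).[z] * reval moebius z.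
  have : \forall z \near y, (1 - 'X).[z] != 0.
    by apply: near_neq0 => //; exact: continuous_horner.
  by apply: filterS => z rz; rewrite /reval/= mulrC divfK.
have := near_eq_taylor n.+1 E; rewrite taylor_horner_eq0; last by rewrite size_poly1.
rewrite taylorM; [|exact: near_derivable_horner|exact: near_derivable_reval].
rewrite !big_ord_recl big1 => [|i _]; last first.
  by rewrite taylor_horner_eq0 ?mul0r// size_one_sub_X.
have D0 : (1 - 'X : {poly R}).[y] = 1 - y by rewrite !hornerE.
have T1 : taylor (horner (1 - 'X)) y 1 = -1.
  rewrite taylorE derive1n_horner derivn1 derivB derivX -polyC1 derivC.
  by rewrite sub0r !hornerE divr1.
rewrite addr0/= subn0 subSS subn0 taylor0 -[bump 0 0]/1%N T1 D0 mulN1r => /esym.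
exact: subr0_eq.
Qed.

Lemma P_moebius d : P_ d [set y : R | y < 1] (reval moebius).
Proof.
move=> y /= y1; have fy := rfinite_moebius y1.
have y0 : 1 - y != 0 by rewrite subr_eq0 gt_eqF.
have td n : times_derivable n (reval moebius) y.
  exact/near_derivable_times/near_derivable_reval.
have d0 : derive1 (reval moebius) y != 0.
  have := taylor_moebiusS 0 y1; rewrite taylor0 taylorE derive1n1 factS fact0 divr1.
  rewrite reval_moebius => E; apply: contra_eq_neq E => ->.
  by rewrite mulr0 eq_sym invr_eq0.
split; [exact: (td (2 * d).+1)|exact: d0|move=> k /andP[k1 _]; exists 0; split=> //].
split; [exact: k1|exact: (td (2 * k).+1)|exact: d0|].
exists moebius, (fun w => 1 - w^-1); split.
- by split; [exact: td|rewrite rdegree_moebius|exact: fy|].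
- split; apply: filterE => z; rewrite reval_moebius.
    by rewrite invrK opprB addrC subrK.
  by rewrite opprB addrC subrK invrK.
have E : \forall z \near y,
    ((fun w => 1 - w^-1) \o reval moebius) z = ('X : {poly R}).[z].
  by apply: filterE => z /=; rewrite reval_moebius hornerX invrK opprB addrC subrK.
rewrite (nbhs_singleton (near_eq_derive1n (2 * k).+1 E)) derive1n_horner.
by rewrite derivn_poly0 ?horner0// size_polyX ltnS muln_gt0.
Qed.

Lemma derive1n_moebius n : derive1n n (reval moebius) 0 = n`!%:R.
Proof.
have T1 : taylor (reval moebius) 0 n = 1.
  elim: n => [|n <-]; first by rewrite taylor0 reval_moebius subr0 invr1.
  by rewrite -[RHS](taylor_moebiusS _ ltr01) subr0 mul1r.
have n0 : n`!%:R != 0 :> R by rewrite pnatr_eq0 -lt0n fact_gt0.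
by move: T1; rewrite taylorE => /(canRL (divfK n0)) ->; rewrite mul1r.
Qed.

Lemma dist_boundary_moebius : dist_boundary [set y : R | y < 1] 0 = 1%E.
Proof.
have oU := @open_lt R 1.
apply/eqP; rewrite eq_le; apply/andP; split.
  have -> : 1%E = `|1 - 0 : R|%:E by rewrite subr0 normr1.
  by apply: dist_boundary_le => //=; rewrite ltxx.
apply: le_dist_boundary => // y; rewrite sub0r normrN /=.
exact: le_lt_trans (ler_norm y).
Qed.

End Moebius.

Theorem theorem2 (R : realType) (d m n : nat)
    (hd : (0 < d)%N) (hn : odd n) (h1n : (1 <= n)%N) (hnm : (n <= m)%N)
    (hmd : (m <= 2 * d)%N) :
  (forall (U : set R) (f : R -> R), open_interval U -> P_ d U f ->
     forall x : R, U x ->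
       (`|derive1n m f x|%:E <=
          (m`!%:R / n`!%:R)%:E * (dist_boundary U x ^+ (m - n))^-1
            * `|derive1n n f x|%:E)%E)
  /\
  (exists (U : set R) (r : rational_map R) (x : R),
     [/\ open_interval U,
         rdegree r = 1%N /\ (forall y : R, U y -> rfinite r y),
         P_ d U (reval r),
         U x &
         `|derive1n m (reval r) x|%:E =
           ((m`!%:R / n`!%:R)%:E * (dist_boundary U x ^+ (m - n))^-1
              * `|derive1n n (reval r) x|%:E)%E
         /\ derive1n m (reval r) x != 0]).
Proof.
split=> [U f UI Pf x Ux|]; first by apply: (P_derive1n_le hn _ UI Pf Ux); rewrite hnm.
exists [set y : R | y < 1], moebius, 0; split.
- split; first exact: open_lt.
  by move=> x y /= _ y1 z /andP[_ /le_lt_trans]; apply.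
- by split; [exact: rdegree_moebius|exact: rfinite_moebius].
- exact: P_moebius.
- exact: ltr01.
rewrite !derive1n_moebius dist_boundary_moebius -EFin_expe expr1n inve1 mule1.
by rewrite !normr_nat -EFinM divfK ?pnatr_eq0 -?lt0n ?fact_gt0.
Qed.
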